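(* Let $\mathbb{K}$ be a countably infinite field, and let $A,B\subset\mathbb{K}$ be sets with positive upper Banach density. Then, for every finite set $Q\subset\mathbb{K}$, there exists $(a_Q,b_Q)\in A\times B$ such that $$Q\subset(A-a_Q)\cdot(B-b_Q).$$ In particular, $\mathbb{K}=(A-A)\cdot(B-B)$.
   Context: Here $S\cdot T=\{st:s\in S,t\in T\}$, $A-a=\{x-a:x\in A\}$ and $A-A=\{x-y:x,y\in A\}$. Upper Banach density is taken in the additive group $(\mathbb{K},+)$: a Følner sequence is a sequence $(F_n)$ of non-empty finite subsets of $\mathbb{K}$ with $|F_n\cap(F_n+b)|/|F_n|\to1$ for every $b\in\mathbb{K}$, and $d^*(E)=\sup_{(F_n)}\limsup_{n\to\infty}|E\cap F_n|/|F_n|$, the supremum being over all such sequences. *)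

(* Defs.v *)
From HB Require Import structures.
From mathcomp Require Import all_boot all_order all_algebra finmap.
From mathcomp Require Import all_classical all_reals all_analysis.
Set Implicit Arguments.
Unset Strict Implicit.
Unset Printing Implicit Defensive.
Import Order.TTheory GRing.Theory Num.Theory.
Import numFieldNormedType.Exports.
Local Open Scope classical_set_scope.
Local Open Scope ring_scope.

Section UpperBanachDensity.
Variables (R : realType) (G : zmodType).

Definition fset_shift (F : {fset G}) (b : G) : {fset G} :=
  [fset (x + b)%R | x in F]%fset.

Definition folner_seq (F : nat -> {fset G}) : Prop :=
  (forall n, F n != fset0) /\
  (forall b : G,
     (fun n => #|` (F n `&` fset_shift (F n) b)%fset|%:R / #|` F n|%:R : R)
       @ \oo --> (1 : R)).

Definition rel_density (E : set G) (F : {fset G}) : R :=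
  #|` [fset x in F | x \in E]%fset|%:R / #|` F|%:R.

Definition upper_banach_density (E : set G) : \bar R :=
  ereal_sup [set limn_esup (fun n => (rel_density E (F n))%:E)
            | F in folner_seq].

End UpperBanachDensity.

Definition set_mul (K : pzRingType) (S T : set K) : set K :=
  [set s * t | s in S & t in T].

Definition set_translate (G : zmodType) (A : set G) (a : G) : set G :=
  [set x - a | x in A].

Definition set_diff (G : zmodType) (A B : set G) : set G :=
  [set x - y | x in A & y in B].

(* Main.v *)
Require Import Defs.
From HB Require Import structures.
From mathcomp Require Import all_boot all_order all_algebra finmap.
From mathcomp Require Import all_classical all_reals all_analysis.
From mathcomp Require Import ring lra.
Set Implicit Arguments.
Unset Strict Implicit.
Unset Printing Implicit Defensive.
Import Order.TTheory GRing.Theory Num.Theory.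
Import numFieldNormedType.Exports.
Local Open Scope classical_set_scope.
Local Open Scope ring_scope.

(** The conditions at [0] cost nothing, and [q <> 0] is in
    [(A - a) * (B - b)] as soon as [(a + u, b + q / u)] lies in [A * B]
    for some [u <> 0]. So the question is one of recurrence in the plane
    along the hyperbola [{(u, q / u)}].

    Positive Banach density provides shift-invariant means [LA], [LB] on
    [K] giving [A] and [B] positive mass ([density_mean]), hence a
    shift-invariant mean [L] on [K * K] with [0 < L (\1_(A `*` B))]. If every
    [(a, b)] failed for some [q] of the finite set [Q], finitely many sets
    of bad pairs would cover [A * B], and one of them would have positive
    mass. By [hyperbolic_recurrence], that set [E] contains two points which
    differ by some [(u, q / u)], and then the first of them is not bad.

    Recurrence is proved by harmonic analysis without any Fourier transform.
    Put [al = L (\1_E)] and [f = \1_E - al]. The correlation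
    [rho p = L (z |-> f z * f (z + p))] is positive definite, and it takes
    the value [- al ^ 2] at each [(u, q / u)] for which no pair of points of
    [E] differs by it. Averaging [rho] over the torus
    [(x, y) |-> (t x, y / t)] with an invariant mean on the multiplicative
    group ([multiplicative_mean]) gives a kernel [Phi] which is still
    positive definite and is now torus invariant: off the vertical axis
    [Phi (x, y)] depends on [x y] only. Were there no recurrence, one would
    have [Phi (1, q) = - al ^ 2 < 0].

    This is impossible by [torus_invariant_hyperbola_ge0], which replaces
    bounds for Kloosterman sums. Regard [Phi (p - p')] as the Gram matrix of
    vectors [v p]. The vectors [v (1, s)] have constant pairwise inner
    products [Phi (0, 1)], so a Bessel inequality forces [s |-> Phi (1, s)],
    the inner products with [v 0], to be constant up to [e] outside a finite
    set of [s]. Hence averages of [v] over sufficiently generic points of two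
    hyperbolas have nearly the same Gram matrix and are close in norm;
    pairing them with [v 0] shows that [Phi (1, s)] is the same for all
    [s <> 0]. Finally a long sum of vectors whose distinct inner products are
    all [Phi (1, q)] would have negative square if [Phi (1, q)] were
    negative. *)

(** * Means on bounded functions and their ultralimits *)

Definition bdd (R : realType) (T : Type) (f : T -> R) :=
  exists M, forall t, `|f t| <= M.

(** Bounded functions only, so that ultralimits of averages qualify: a limit
    along an ultrafilter is uninformative on unbounded sequences. *)
Record mean (R : realType) (T : Type) (L : (T -> R) -> R) : Prop := {
  meanD : forall f g, bdd f -> bdd g -> L (fun t => f t + g t) = L f + L g;
  meanZ : forall c f, bdd f -> L (fun t => c * f t) = c * L f;
  mean_ge0 : forall f, bdd f -> (forall t, 0 <= f t) -> 0 <= L f;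
  mean1 : L (fun=> 1) = 1 }.

Definition shift_invariant (R : realType) (G : zmodType)
    (L : (G -> R) -> R) :=
  forall b f, bdd f -> L (fun x => f (x + b)) = L f.

Lemma bdd_cst (R : realType) T (c : R) : bdd (fun _ : T => c).
Proof. by exists `|c|. Qed.

Lemma bddD (R : realType) T (f g : T -> R) :
  bdd f -> bdd g -> bdd (fun t => f t + g t).
Proof.
move=> [M fM] [N gN]; exists (M + N) => t.
exact: le_trans (ler_normD _ _) (lerD (fM t) (gN t)).
Qed.

Lemma bddM (R : realType) T (f g : T -> R) :
  bdd f -> bdd g -> bdd (fun t => f t * g t).
Proof.
by move=> [M fM] [N gN]; exists (M * N) => t; rewrite normrM ler_pM.
Qed.

Lemma bdd_sum (R : realType) T I (r : seq I) (f : I -> T -> R) :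
  (forall i, bdd (f i)) -> bdd (fun t => \sum_(i <- r) f i t).
Proof.
move=> fb; elim: r => [|i r IH].
  by exists 0 => t; rewrite big_nil normr0.
rewrite (_ : (fun t => _) = fun t => f i t + \sum_(j <- r) f j t).
  exact: bddD.
by apply/funext => t; rewrite big_cons.
Qed.

Lemma bdd_comp (R : realType) T S (s : S -> T) (f : T -> R) :
  bdd f -> bdd (fun t => f (s t)).
Proof. by move=> [M fM]; exists M. Qed.

Lemma bdd_indic (R : realType) T (E : set T) : bdd (\1_E : T -> R).
Proof. by exists 1 => t; rewrite indicE ger0_norm // lern1 leq_b1. Qed.

Lemma mean_cst (R : realType) T (L : (T -> R) -> R) c :
  mean L -> L (fun=> c) = c.
Proof.
move=> mL; rewrite -[RHS]mulr1 -[X in _ * X](mean1 mL) -meanZ //.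
  by congr L; apply/funext => t; rewrite mulr1.
exact: bdd_cst.
Qed.

Lemma meanB (R : realType) T (L : (T -> R) -> R) f g : mean L ->
  bdd f -> bdd g -> L (fun t => f t - g t) = L f - L g.
Proof.
move=> mL fb gb; rewrite -[- L g]mulN1r -meanZ // -meanD //.
  by congr L; apply/funext => t; rewrite mulN1r.
by apply: bddM gb; exact: bdd_cst.
Qed.

Lemma mean_sum (R : realType) T (L : (T -> R) -> R) I (r : seq I)
    (f : I -> T -> R) : mean L -> (forall i, bdd (f i)) ->
  L (fun t => \sum_(i <- r) f i t) = \sum_(i <- r) L (f i).
Proof.
move=> mL fb; elim: r => [|i r IH].
  rewrite big_nil -[RHS](mean_cst 0 mL).
  by congr L; apply/funext => t; rewrite big_nil.
rewrite big_cons -IH -meanD //; last exact: bdd_sum.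
by congr L; apply/funext => t; rewrite big_cons.
Qed.

Lemma mean_le (R : realType) T (L : (T -> R) -> R) f g : mean L ->
  bdd f -> bdd g -> (forall t, f t <= g t) -> L f <= L g.
Proof.
move=> mL fb gb fg; rewrite -subr_ge0 -meanB //; apply: (mean_ge0 mL).
  apply: bddD => //; case: fb => M fM; exists M => t.
  by rewrite normrN.
by move=> t; rewrite subr_ge0.
Qed.

Lemma mean_norm (R : realType) T (L : (T -> R) -> R) f M : mean L ->
  (forall t, `|f t| <= M) -> `|L f| <= M.
Proof.
move=> mL fM; have fb : bdd f by exists M.
rewrite ler_norml -[X in X <= _](mean_cst (- M) mL).
rewrite -[X in _ && (_ <= X)](mean_cst M mL).
by apply/andP; split; apply: mean_le => //; try exact: bdd_cst;
  move=> t; have := fM t; rewrite ler_norml => /andP[].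
Qed.

Lemma mean_eq_approx (R : realType) T (L : (T -> R) -> R) f g e : mean L ->
  bdd f -> bdd g -> (forall t, `|f t - g t| <= e) -> `|L f - L g| <= e.
Proof. by move=> mL fb gb fg; rewrite -meanB //; exact: mean_norm. Qed.

Lemma prod_mean (R : realType) S T (L : (S -> R) -> R) (L' : (T -> R) -> R) :
  mean L -> mean L' ->
  mean (fun f : S * T -> R => L (fun s => L' (fun t => f (s, t)))).
Proof.
move=> mL mL'.
have bL f : bdd f -> bdd (fun s => L' (fun t => f (s, t))).
  by move=> [M fM]; exists M => s; apply: mean_norm.
have bC f s : bdd f -> bdd (fun t => f (s, t)) by move=> [M fM]; exists M.
split=> [f g fb gb|c f fb|f fb f0|].
- rewrite -meanD; try exact: bL; try exact: mL.
  congr L; apply/funext => s; rewrite -meanD //; exact: bC.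
- rewrite -meanZ; try exact: bL; try exact: mL.
  congr L; apply/funext => s; rewrite -meanZ //; exact: bC.
- apply: (mean_ge0 mL); first exact: bL.
  move=> s; apply: (mean_ge0 mL') => //; exact: bC.
- rewrite -[RHS](mean1 mL); congr L; apply/funext => s; exact: (mean1 mL').
Qed.

Lemma map_mean (R : realType) S T (s : S -> T) (L : (S -> R) -> R) :
  mean L -> mean (fun f : T -> R => L (fun x => f (s x))).
Proof.
move=> mL; split=> [f g fb gb|c f fb|f fb f0|]; last exact: (mean1 mL).
- rewrite -meanD //; exact: bdd_comp.
- rewrite -meanZ //; exact: bdd_comp.
- by apply: (mean_ge0 mL) => //; exact: bdd_comp.
Qed.

Lemma average_mean (R : realType) (T : Type) (r : seq T) : (0 < size r)%N ->
  mean (fun f : T -> R => (\sum_(x <- r) f x) / (size r)%:R).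
Proof.
move=> r0; split=> [f g _ _|c f _|f _ f0|].
- by rewrite big_split /= mulrDl.
- by rewrite -mulr_sumr mulrA.
- by rewrite divr_ge0 // sumr_ge0.
- by rewrite big_const_seq count_predT iter_addr_0 divff // pnatr_eq0 -lt0n.
Qed.

(** A cluster point exists by compactness, and an ultrafilter converges to
    each of its cluster points. *)
Lemma ultra_cvg (R : realType) (I : Type) (U : set_system I) (x : I -> R) :
  UltraFilter U -> bdd x -> x @ U --> lim (x @ U).
Proof.
move=> UU [M xM]; suff : cvg (x @ U) by [].
have [|p [_ pc]] := @segment_compact R (- M) M (x @ U) _.
  by apply: nearW => i /=; rewrite in_itv /= -ler_norml.
apply/cvg_ex; exists p => V Vp.
have [//|nV] := in_ultra_setVsetC (x @^-1` V) UU.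
by have [y []] := pc (~` V) V nV Vp.
Qed.

Lemma ultralimit_mean (R : realType) (I T : Type) (U : set_system I)
    (L : I -> (T -> R) -> R) : UltraFilter U -> (forall i, mean (L i)) ->
  mean (fun f => lim ((fun i => L i f) @ U)).
Proof.
move=> UU mL.
have c f : bdd f -> (fun i => L i f) @ U --> lim ((fun i => L i f) @ U).
  by move=> [M fM]; apply: ultra_cvg; exists M => i; exact: mean_norm.
split=> [f g fb gb|a f fb|f fb f0|].
- apply: cvg_lim => //; rewrite (_ : (fun i => _) = fun i => L i f + L i g).
    by apply: cvgD; exact: c.
  by apply/funext => i; rewrite meanD.
- apply: cvg_lim => //; rewrite (_ : (fun i => _) = fun i => a * L i f).
    by apply: cvgMr; exact: c.
  by apply/funext => i; rewrite meanZ.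
- apply: (cvgr_to_ge (c _ fb)); apply: nearW => i; exact: (mean_ge0 (mL i)).
- apply: cvg_lim => //; rewrite (_ : (fun i => _) = fun=> 1).
    exact: cvg_cst.
  by apply/funext => i; exact: (mean1 (mL i)).
Qed.

Lemma ultralimit_eq (R : realType) (I T : Type) (U : set_system I)
    (L : I -> (T -> R) -> R) (f g : T -> R) : UltraFilter U ->
  (forall i, mean (L i)) -> bdd f -> bdd g ->
  (fun i => `|L i f - L i g|) @ U --> 0 ->
  lim ((fun i => L i f) @ U) = lim ((fun i => L i g) @ U).
Proof.
move=> UU mL fb gb h.
have c k : bdd k -> (fun i => L i k) @ U --> lim ((fun i => L i k) @ U).
  by move=> [M kM]; apply: ultra_cvg; exists M => i; exact: mean_norm.
apply/eqP; rewrite -subr_eq0; apply/eqP.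
apply: cvg_unique (cvgB (c _ fb) (c _ gb)) _ => //.
exact/norm_cvg0P.
Qed.

(** * Shift-invariant means detecting positive Banach density *)

(** The common terms cancel; what remains is a sum over the symmetric
    difference of the two lists. *)
Lemma sum_uniq_dist (R : realType) (T : choiceType) (r s : seq T)
    (f : T -> R) M :
  uniq r -> uniq s -> (forall x, `|f x| <= M) ->
  `|\sum_(x <- r) f x - \sum_(x <- s) f x| <=
    M * ((size r)%:R + (size s)%:R - (count (mem s) r)%:R *+ 2).
Proof.
move=> ur us fM.
have part (u v : seq T) : `|\sum_(x <- u | x \notin v) f x| <=
    M * ((size u)%:R - (count (mem v) u)%:R).
  apply: le_trans (ler_norm_sum _ _ _) _.
  apply: (@le_trans _ _ (\sum_(x <- u | x \notin v) M)).
    by apply: ler_sum => x _.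
  rewrite big_const_seq iter_addr_0 -[leLHS]mulr_natr.
  by rewrite -(count_predC (mem v) u) natrD addrAC subrr add0r.
have common : perm_eq [seq x <- r | x \in s] [seq x <- s | x \in r].
  apply: uniq_perm; rewrite ?filter_uniq // => x.
  by rewrite !mem_filter andbC.
rewrite (bigID (mem s)) [X in _ - X](bigID (mem r)) /=.
rewrite -big_filter -[X in _ - (X + _)]big_filter (perm_big _ common) /=.
rewrite opprD addrACA subrr add0r.
apply: le_trans (ler_normB _ _) _.
apply: le_trans (lerD (part r s) (part s r)) _.
rewrite -(size_filter (mem r) s) -(perm_size common) size_filter.
by rewrite le_eqVlt; apply/orP; left; apply/eqP; ring.
Qed.

Definition fset_average (R : realType) (G : choiceType) (F : {fset G})
    (f : G -> R) : R := (\sum_(x <- F) f x) / (size F)%:R.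

Lemma fset_average_shift (R : realType) (G : zmodType) (F : {fset G}) b
    (f : G -> R) M : F != fset0 -> (forall x, `|f x| <= M) ->
  `|fset_average F (fun x => f (x + b)) - fset_average F f| <=
   2 * M * (1 - #|` (F `&` fset_shift F b)%fset|%:R / #|` F|%:R).
Proof.
move=> F0 fM.
have sF : (0 < size F)%N by rewrite cardfs_gt0.
rewrite /fset_average -mulrBl normrM normfV [X in _ * X^-1 <= _]ger0_norm //.
rewrite ler_pdivrMr ?ltr0n //.
have inj : injective (fun x : G => x + b) by exact: addIr.
have -> : \sum_(x <- F) f (x + b) = \sum_(x <- fset_shift F b) f x.
  by rewrite big_imfset //= => x y _ _; exact: inj.
apply: le_trans (sum_uniq_dist (fset_uniq _) (fset_uniq _) fM) _.
have -> : size (fset_shift F b) = size F by rewrite card_imfset.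
have -> : count (mem F) (fset_shift F b) = #|` (F `&` fset_shift F b)%fset|.
  rewrite -size_filter; apply: perm_size; apply: uniq_perm => //.
    by rewrite filter_uniq.
  by move=> x; rewrite mem_filter in_fsetI.
rewrite le_eqVlt; apply/orP; left; apply/eqP.
by field; rewrite pnatr_eq0 -lt0n.
Qed.

Lemma rel_densityE (R : realType) (G : zmodType) (E : set G) (F : {fset G}) :
  rel_density R E F = fset_average F (\1_E).
Proof.
rewrite /rel_density /fset_average; congr (_ / _).
under eq_bigr do rewrite indicE.
rewrite -natr_sum; congr (_%:R).
rewrite -sum1_size -big_fset_condE big_mkcond /=.
by apply: eq_bigr => x _; case: (x \in E).
Qed.

(** A positive upper limit along some Folner sequence amounts to a fixed
    lower bound for the relative densities infinitely often. *)
Lemma upper_banach_density_gt0 (R : realType) (G : zmodType) (E : set G) :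
  (0 < upper_banach_density R E)%E ->
  exists F : nat -> {fset G}, folner_seq R F /\ exists2 d : R, 0 < d &
    forall V : set nat, \oo V -> exists2 n, V n & d < rel_density R E (F n).
Proof.
move=> /ereal_sup_gt [_ [F fF <-]]; rewrite /limn_esup /limf_esup => pos.
exists F; split => //.
set l := ereal_inf _ in pos.
have [d d0 dl] : exists2 d : R, 0 < d & (d%:E < l)%E.
  case: l pos => [r| |] //; rewrite ?lte_fin => r0.
    by exists (r / 2); rewrite ?lte_fin; lra.
  by exists 1; rewrite ?ltry.
exists d => // V oV.
have : (d%:E < ereal_sup ((fun n => (rel_density R E (F n))%:E) @` V))%E.
  by apply: lt_le_trans dl _; apply: ereal_inf_lbound; exists V.
by move=> /ereal_sup_gt [_ [n Vn <-]]; rewrite lte_fin => ?; exists n.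
Qed.

(** The ultrafilter refines the tails of the Folner sequence, which gives
    shift invariance, and it contains the indices of large relative density,
    which keeps the mass of [E] positive. *)
Lemma density_mean (R : realType) (G : zmodType) (E : set G) :
  (0 < upper_banach_density R E)%E ->
  exists L : (G -> R) -> R, [/\ mean L, shift_invariant L & 0 < L (\1_E)].
Proof.
move=> /upper_banach_density_gt0[F [[F0 Ffolner] [d d0 dP]]].
pose D := [set n | d < rel_density R E (F n)].
have pD : ProperFilter (within D \oo).
  apply: Build_ProperFilter_ex => V /dP[n Vn Dn]; exists n; exact: Vn.
have [U [UU subU]] := ultraFilterLemma pD.
have ooU V : \oo V -> U V.
  by move=> oV; apply: subU; apply: filterS oV => n.
have UD : U D by apply: subU; exact: nearW.
have mF n : mean (fset_average (R := R) (F n)).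
  by apply: average_mean; rewrite cardfs_gt0.
exists (fun f => lim ((fun n => fset_average (F n) f) @ U)); split.
- exact: ultralimit_mean.
- move=> b f fb.
  apply: (ultralimit_eq (L := fun n => fset_average (F n))) => //.
    exact: bdd_comp.
  case: fb => M fM.
  pose q n : R := 2 * M *
    (1 - #|` (F n `&` fset_shift (F n) b)%fset|%:R / #|` F n|%:R).
  apply: (@squeeze_cvgr _ _ _ _ (fun=> 0) q) => /=.
  + apply: nearW => n; rewrite normr_ge0 /=; exact: fset_average_shift.
  + exact: cvg_cst.
  + apply: (@cvg_trans _ (q @ \oo)); first by move=> V; exact: ooU.
    rewrite -(mulr0 (2 * M)) -(subrr 1); apply: cvgMr; apply: cvgB.
      exact: cvg_cst.
    exact: Ffolner.
- apply: (lt_le_trans d0).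
  have c : (fun n => fset_average (F n) (\1_E : G -> R)) @ U -->
           lim ((fun n => fset_average (F n) (\1_E : G -> R)) @ U).
    apply: ultra_cvg; exists 1 => n; apply: mean_norm => //.
    by move=> x; rewrite indicE ger0_norm // lern1 leq_b1.
  apply: (cvgr_to_ge c).
  by apply: filterS UD => n; rewrite /D /= rel_densityE => /ltW.
Qed.

(** * An invariant mean on the multiplicative group of a field *)

(** The average of [f] over the products of powers [g ^+ j] with [j <= n],
    one factor for each [g] in [gs], counted with multiplicity. Such boxes
    are the usual Folner sets of a finitely generated abelian group. *)
Fixpoint box_average (R : realType) (K : fieldType) (gs : seq K) (n : nat)
    (f : K -> R) : R :=
  if gs is g :: gs' then
    (\sum_(j <- index_iota 0 n.+1) box_average gs' n (fun t => f (g ^+ j * t)))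
      / (size (index_iota 0 n.+1))%:R
  else f 1.

Lemma box_average_mean (R : realType) (K : fieldType) (gs : seq K) n :
  mean (@box_average R K gs n).
Proof.
elim: gs => [|g gs IH] /=; first by split.
have s0 : (0 < size (index_iota 0 n.+1))%N by rewrite size_iota.
exact: (map_mean (fun jt : nat * K => g ^+ jt.1 * jt.2)
  (prod_mean (average_mean R s0) IH)).
Qed.

(** Multiplying by one of the generators shifts one side of the box: the sum
    over that side telescopes to two boundary terms. *)
Lemma box_average_shift (R : realType) (K : fieldType) (gs : seq K) n h
    (f : K -> R) M : h \in gs -> (forall t, `|f t| <= M) ->
  `|box_average gs n (fun t => f (h * t)) - box_average gs n f|
    <= 2 * M / n.+1%:R.
Proof.
move=> + fM; elim: gs f fM => [//|g gs IH] f fM.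
have mb := @box_average_mean R K gs n.
have bb j x : `|box_average gs n (fun t => f (x * (g ^+ j * t)))| <= M.
  exact: mean_norm.
have bb' j : `|box_average gs n (fun t => f (g ^+ j * t))| <= M.
  exact: mean_norm.
rewrite inE => /orP[/eqP->|hgs] /=.
  rewrite size_iota -mulrBl -sumrB normrM normfV.
  rewrite [X in _ * X^-1 <= _]ger0_norm //.
  rewrite ler_pM2r ?invr_gt0 //.
  under eq_bigr => j _.
    rewrite (_ : (fun t => _) = fun t => f (g ^+ j.+1 * t)); last first.
      by apply/funext => t; rewrite exprS mulrA.
    over.
  rewrite telescope_sumr //; apply: le_trans (ler_normB _ _) _.
  by rewrite mulr_natl mulr2n lerD.
have s0 : (0 < size (index_iota 0 n.+1))%N by rewrite size_iota.
have := @mean_eq_approx _ _ _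
  (fun j => box_average gs n (fun t => f (h * (g ^+ j * t))))
  (fun j => box_average gs n (fun t => f (g ^+ j * t)))
  (2 * M / n.+1%:R) (average_mean R s0).
apply; [by exists M|by exists M|move=> j].
rewrite (_ : (fun t => f (h * _)) = fun t => f (g ^+ j * (h * t))); last first.
  by apply/funext => t; rewrite mulrCA.
exact: (IH (fun t => f (g ^+ j * t))).
Qed.

(** Boxes consist of nonzero elements. This keeps the limit mean off [0],
    where the point mass is invariant under dilations as well. *)
Lemma box_average_ext (R : realType) (K : fieldType) (gs : seq K) n
    (f f' : K -> R) : all (fun g => g != 0) gs ->
  (forall t, t != 0 -> f t = f' t) ->
  box_average gs n f = box_average gs n f'.
Proof.
elim: gs f f' => [|g gs IH] f f' /=; first by move=> _; apply; exact: oner_neq0.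
move=> /andP[g0 gs0] ff'; congr (_ / _); apply: eq_bigr => j _.
by apply: IH => // t t0; rewrite ff' // mulf_neq0 ?expf_neq0.
Qed.

(** Ultralimit of box averages generated by the nonzero elements among the
    first [n] terms of an enumeration of [K], with side length [n + 1]. *)
Lemma multiplicative_mean (R : realType) (K : fieldType) :
  countable [set: K] ->
  exists L : (K -> R) -> R, [/\ mean L,
    forall g f, g != 0 -> bdd f -> L (fun t => f (g * t)) = L f &
    forall f f', (forall t, t != 0 -> f t = f' t) -> L f = L f'].
Proof.
move=> Kc.
have [e eP] : exists e : nat -> K, forall x, exists n, e n = x.
  have /countable_injP[c cI] := Kc.
  exists (fun n => if pselect (exists x, c x = n) is left h then sval (cid h)
                   else 1) => x.
  exists (c x); case: pselect => [h|[]]; last by exists x.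
  by apply: cI; rewrite ?in_setE //; exact: (svalP (cid h)).
have [U [UU ooU]] := ultraFilterLemma eventually_filter.
pose gs n := [seq g <- map e (iota 0 n) | g != 0].
have mb n := @box_average_mean R K (gs n) n.
exists (fun f => lim ((fun n => box_average (gs n) n f) @ U)); split.
- exact: ultralimit_mean.
- move=> g f g0 fb.
  apply: (ultralimit_eq (L := fun n => box_average (gs n) n)) => //.
    exact: bdd_comp.
  case: fb => M fM; have [i iP] := eP g.
  pose q n : R := 2 * M * n.+1%:R^-1.
  apply: (@squeeze_cvgr _ _ _ _ (fun=> 0) q) => /=.
  + apply: ooU; exists i.+1 => // n /= lin; rewrite normr_ge0 /=.
    apply: box_average_shift => //; rewrite mem_filter g0 -iP.
    by apply: map_f; rewrite mem_iota.
  + exact: cvg_cst.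
  + apply: (@cvg_trans _ (q @ \oo)); first by move=> V; exact: ooU.
    rewrite -(mulr0 (2 * M)); apply: cvgMr; exact: cvg_harmonic.
- move=> f f' ff'; congr (lim (_ @ U)); apply/funext => n.
  by apply: box_average_ext => //; exact: filter_all.
Qed.

(** * Torus-invariant positive definite kernels on the plane *)

Definition positive_definite (R : realType) (G : zmodType) (Phi : G -> R) :=
  forall n (a : 'I_n -> R) (p : 'I_n -> G),
    0 <= \sum_i \sum_j a i * a j * Phi (p i - p j).

(** Cauchy-Schwarz between the vector at the origin and [\sum_i a i v_(p i)],
    kept as a nonnegative quadratic polynomial in [l]: the squared norm of
    their combination with weights [l] and [1]. *)
Lemma pd_cauchy_schwarz (R : realType) (G : zmodType) (Phi : G -> R)
    n (a : 'I_n -> R) (p : 'I_n -> G) (l : R) :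
  positive_definite Phi -> (forall x, Phi (- x) = Phi x) ->
  0 <= l ^+ 2 * Phi 0 + 2 * l * (\sum_i a i * Phi (p i)) +
       \sum_i \sum_j a i * a j * Phi (p i - p j).
Proof.
move=> pd sym.
have := pd n.+1 (fun i => if unlift ord0 i is Some j then a j else l)
                (fun i => if unlift ord0 i is Some j then p j else 0).
rewrite big_ord_recl big_ord_recl unlift_none subrr.
under eq_bigr => i _ do rewrite liftK sub0r sym.
under [X in _ + X]eq_bigr => i _.
  rewrite big_ord_recl unlift_none liftK subr0.
  under eq_bigr => j _ do rewrite liftK.
  over.
rewrite big_split /= => h; apply: le_trans h _.
rewrite le_eqVlt; apply/orP; left.
apply/eqP; rewrite addrA; congr (_ + _).
rewrite expr2 -addrA; congr (_ + _).
rewrite -mulrA mulrDl !mul1r mulr_sumr; congr (_ + _).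
  by apply: eq_bigr => i _; rewrite mulrA.
by apply: eq_bigr => i _; ring.
Qed.

Lemma pd_bound (R : realType) (G : zmodType) (Phi : G -> R) x :
  positive_definite Phi -> (forall x, Phi (- x) = Phi x) ->
  `|Phi x| <= Phi 0.
Proof.
move=> pd sym.
have h l := @pd_cauchy_schwarz R G Phi 1 (fun=> 1) (fun=> x) l pd sym.
have := h 1; have := h (-1); rewrite !big_ord1 subrr => h1 h2.
by rewrite ler_norml; apply/andP; split; lra.
Qed.

Lemma infinite_fresh (K : choiceType) : infinite_set [set: K] ->
  forall s : seq K, exists x, x \notin s.
Proof.
move=> Kinf s; apply: contrapT => h; apply: Kinf.
apply/finite_seqP; exists s; apply/seteqP; split=> // x _ /=.
by apply: contrapT => /negP xs; apply: h; exists x.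
Qed.

Lemma infinite_uniq (K : choiceType) : infinite_set [set: K] ->
  forall n, exists s : seq K, size s = n /\ uniq s.
Proof.
move=> Kinf; elim=> [|n [s [sz us]]]; first by exists [::].
have [x xs] := infinite_fresh Kinf s.
by exists (x :: s); rewrite /= sz xs us.
Qed.

Lemma infinite_nonroot (K : fieldType) : infinite_set [set: K] ->
  forall p : {poly K}, p != 0 -> exists x, ~~ root p x.
Proof.
move=> Kinf p p0; have [s [sz us]] := infinite_uniq Kinf (size p).
apply: contrapT => h.
have : all (root p) s.
  by apply/allP => x _; apply: contrapT => /negP xr; apply: h; exists x.
by move=> /(max_poly_roots p0) /(_ us); rewrite sz ltnn.
Qed.

(** For a given [p], the condition that [(u, s / u) - p] has coordinate
    product [e] is a polynomial equation in [u], with constant term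
    [- p.1 * s <> 0]. So only finitely many [u] are to be avoided. *)
Lemma generic_hyperbola_point (K : fieldType) (P : seq (K * K)) (Ex : seq K)
    (s : K) : infinite_set [set: K] -> s != 0 ->
  all (fun p : K * K => p.1 != 0) P ->
  exists2 r : K * K, r.1 != 0 /\ r.1 * r.2 = s &
    all (fun p : K * K => (r - p).1 * (r - p).2 \notin Ex) P.
Proof.
move=> Kinf s0 P0.
pose f (p : K * K) e : {poly K} :=
  ('X - p.1%:P) * (s%:P - p.2%:P * 'X) - e%:P * 'X.
pose F := 'X * \prod_(p <- P) \prod_(e <- Ex) f p e.
have f0 p e : p.1 != 0 -> f p e != 0.
  move=> p0; apply: contraNneq p0 => /(congr1 (fun q => q.[0])).
  rewrite /f !hornerE => /eqP.
  by rewrite !subr0 mulNr oppr_eq0 mulf_eq0 (negPf s0) orbF.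
have F0 : F != 0.
  rewrite mulf_neq0 ?polyX_eq0 // prodf_seq_neq0; apply/allP => p pP /=.
  rewrite prodf_seq_neq0; apply/allP => e _ /=; apply: f0.
  exact: (allP P0).
have [u] := infinite_nonroot Kinf F0.
rewrite rootM negb_or rootX => /andP[u0 uF].
exists (u, s / u) => /=; first by rewrite mulrC divfK.
apply/allP => p pP; apply: contra uF => eEx.
rewrite /root horner_prod (big_rem p) //= mulf_eq0; apply/orP; left.
rewrite horner_prod (big_rem _ eEx) /= mulf_eq0; apply/orP; left.
rewrite /f !hornerE; apply/eqP; field.
exact: u0.
Qed.

Lemma generic_hyperbola_points (K : fieldType) (Ex ss : seq K) :
  infinite_set [set: K] -> all (fun s => s != 0) ss ->
  exists rs : seq (K * K), [/\ [seq r.1 * r.2 | r <- rs] = ss,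
    all (fun p : K * K => p.1 != 0) rs &
    pairwise (fun r p : K * K => (r - p).1 * (r - p).2 \notin Ex) rs].
Proof.
move=> Kinf; elim: ss => [|s ss IH] /=; first by exists [::].
move=> /andP[s0 /IH[rs [<- rs0 prs]]].
have [r [r0 rs'] rP] := generic_hyperbola_point Ex Kinf s0 rs0.
by exists (r :: rs); rewrite /= rs' r0 rs0 rP prs.
Qed.

(** Invariance under the diagonal torus of SL2, whose orbits are the
    hyperbolas [x y = const]. *)
Definition torus_invariant (R : realType) (K : fieldType)
    (Phi : K * K -> R) :=
  forall t x y, t != 0 -> Phi (t * x, y / t) = Phi (x, y).

Lemma torus_invariantE (R : realType) (K : fieldType) (Phi : K * K -> R) :
  torus_invariant Phi ->
  forall x y, x != 0 -> Phi (x, y) = Phi (1, x * y).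
Proof. by move=> inv x y x0; rewrite -(inv x 1) // mulr1 mulrC mulKf. Qed.

Lemma torus_invariant_even (R : realType) (K : fieldType) (Phi : K * K -> R) :
  torus_invariant Phi ->
  forall p, Phi (- p) = Phi p.
Proof.
move=> inv [x y]; rewrite -(inv (-1) x y) ?oppr_eq0 ?oner_eq0 //.
by rewrite invrN1 mulrN1 mulN1r.
Qed.

Lemma archimedean_succ (R : realType) (a e : R) : 0 < e ->
  exists N : nat, a < N.+1%:R * e.
Proof.
move=> e0; exists (Num.truncn (a / e)).
by rewrite -ltr_pdivrMr // truncnS_gt.
Qed.


(** The common engine of the two steps below. If all the off-diagonal inner
    products of [2 N] vectors are within [e] of [c], then the sum of the first
    half minus the sum of the second half has squared norm of order
    [N + N ^ 2 e], since [c] is cancelled by the signs. Its inner product with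
    the vector at the origin is at least [N d], so Cauchy-Schwarz bounds
    [d]. *)
Lemma pd_separation (R : realType) (G : zmodType) (Phi : G -> R)
    N (p : 'I_(N + N) -> G) (c e d : R) :
  positive_definite Phi -> (forall x, Phi (- x) = Phi x) ->
  0 <= e -> `|c| <= Phi 0 -> 0 <= d ->
  (forall i j, i != j -> `|Phi (p i - p j) - c| <= e) ->
  (forall i : 'I_N, d <= Phi (p (lshift N i)) - Phi (p (rshift N i))) ->
  N%:R * d ^+ 2 <= 4 * Phi 0 ^+ 2 + 4 * N%:R * Phi 0 * e.
Proof.
move=> pd sym e0 cle d0 pc pdist.
pose s (i : 'I_(N + N)) : R := if (i < N)%N then 1 else -1.
have sl i : s (lshift N i) = 1 by rewrite /s /= ltn_ord.
have sr i : s (rshift N i) = -1 by rewrite /s /= ltnNge leq_addr.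
have s1 i : `|s i| = 1 by rewrite /s; case: ifP => _; rewrite ?normrN normr1.
have sum_s : \sum_i s i = 0.
  rewrite big_split_ord /=; under eq_bigr do rewrite sl.
  under [X in _ + X]eq_bigr do rewrite sr.
  by rewrite sumrN subrr.
have gram : \sum_i \sum_j s i * s j * Phi (p i - p j) <=
    (N + N)%:R * (2 * Phi 0 + (N + N)%:R * e).
  have -> : \sum_i \sum_j s i * s j * Phi (p i - p j) =
            \sum_i \sum_j s i * s j * (Phi (p i - p j) - c).
    apply/eqP; rewrite -subr_eq0 -sumrB.
    under eq_bigr => i _.
      rewrite -sumrB; under eq_bigr => j _.
        rewrite -mulrBr opprB addrC subrK -mulrA [s j * c]mulrC mulrA; over.
      rewrite -mulr_sumr sum_s mulr0; over.
    by rewrite sumr_const mul0rn.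
  apply: (@le_trans _ _ (\sum_(i < N + N) (2 * Phi 0 + (N + N)%:R * e))).
    apply: ler_sum => i _.
    rewrite (bigD1 i) //=; apply: lerD.
      apply: le_trans (ler_norm _) _; rewrite !normrM !s1 !mul1r subrr.
      apply: le_trans (ler_normB _ _) _.
      rewrite (@ger0_norm _ (Phi 0)); last exact: le_trans (normr_ge0 _) cle.
      lra.
    apply: (@le_trans _ _ (\sum_(j < N + N | j != i) e)).
      apply: ler_sum => j ji; apply: le_trans (ler_norm _) _.
      by rewrite !normrM !s1 !mul1r pc // eq_sym.
    rewrite sumr_const -[leLHS]mulr_natl ler_wpM2r // ler_nat.
    by apply: leq_trans (max_card _) _; rewrite card_ord.
  by rewrite sumr_const card_ord -[leLHS]mulr_natl.
have lin : N%:R * d <= \sum_i s i * Phi (p i).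
  rewrite big_split_ord /= -big_split /=.
  apply: (@le_trans _ _ (\sum_(i < N) d)).
    by rewrite sumr_const card_ord -[leRHS]mulr_natl.
  by apply: ler_sum => i _; rewrite sl sr mul1r mulN1r.
set S := \sum_i s i * Phi (p i) in lin.
have cs l := @pd_cauchy_schwarz R G Phi _ s p l pd sym.
have a0 : 0 <= Phi 0 := le_trans (normr_ge0 _) cle.
have [->|N0] := eqVneq N 0%N.
  by rewrite mul0r mulr0 !mul0r addr0 mulr_ge0 // sqr_ge0.
have n0 : 0 < N%:R :> R by rewrite ltr0n lt0n.
move: a0; rewrite le_eqVlt => /orP[/eqP a0|a0].
  have Phi0 x : Phi x = 0.
    by apply/eqP; rewrite -normr_le0 a0; exact: pd_bound.
  suff -> : d = 0 by rewrite expr0n /= mulr0 -a0 expr0n /= !mulr0 mul0r addr0.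
  apply/eqP; rewrite eq_le d0 andbT.
  have Nlt : (0 < N)%N by rewrite lt0n.
  have := pdist (Ordinal Nlt).
  by rewrite !Phi0 subrr.
(* The minimiser of the quadratic polynomial in [l]. *)
have := cs (- (N%:R * d / Phi 0)).
rewrite -/S => h.
have : 0 <= Phi 0 * ((- (N%:R * d / Phi 0)) ^+ 2 * Phi 0 +
   2 * - (N%:R * d / Phi 0) * (N%:R * d) +
   (N + N)%:R * (2 * Phi 0 + (N + N)%:R * e)).
  rewrite pmulr_rge0 //; apply: le_trans h _.
  apply: lerD gram; rewrite lerD2l !mulrN !mulNr lerN2.
  by apply: ler_wpM2l lin; rewrite !mulr_ge0 // ?invr_ge0 ltW.
have -> : Phi 0 * ((- (N%:R * d / Phi 0)) ^+ 2 * Phi 0 +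
   2 * - (N%:R * d / Phi 0) * (N%:R * d) +
   (N + N)%:R * (2 * Phi 0 + (N + N)%:R * e)) =
   N%:R * (4 * Phi 0 ^+ 2 + 4 * N%:R * Phi 0 * e - N%:R * d ^+ 2).
  by rewrite natrD; field; rewrite gt_eqF.
by rewrite pmulr_rge0 // subr_ge0.
Qed.

(** The differences of the points [(1, s)] are [(0, y)], where the kernel has
    the single value [Phi (0, 1)] for [y <> 0]. So [pd_separation] applies with
    [e = 0] and bounds the number of disjoint pairs [(s, s')] whose values
    differ by more than [e]; the members of a maximal family of such pairs
    form the exceptional set. *)
Lemma torus_invariant_almost_constant (R : realType) (K : fieldType)
    (Phi : K * K -> R) (e : R) :
  positive_definite Phi ->
  torus_invariant Phi ->
  0 < e ->
  exists Ex : seq K, forall s s', s \notin Ex -> s' \notin Ex ->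
    Phi (1, s) - Phi (1, s') <= e.
Proof.
move=> pd inv e0.
have sym := torus_invariant_even inv.
pose good (l : seq (K * K)) := uniq (unzip1 l ++ unzip2 l) /\
  all (fun x => e <= Phi (1, x.1) - Phi (1, x.2)) l.
have bd : exists n, forall l, good l -> (size l < n)%N.
  have [N NP] := archimedean_succ (4 * Phi 0 ^+ 2) (exprn_gt0 2 e0).
  exists N.+1 => l [ul al].
  pose p (i : 'I_(size l + size l)) : K * K :=
    (1, nth 0 (unzip1 l ++ unzip2 l) i).
  have h := @pd_separation R (K * K)%type Phi (size l) p (Phi (0, 1)) 0 e
    pd sym.
  rewrite -(ltr_nat R) -(ltr_pM2r (exprn_gt0 2 e0)).
  apply: le_lt_trans NP.
  have := h (lexx _) (pd_bound _ pd sym) (ltW e0).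
  rewrite mulr0 addr0; apply.
    move=> i j ij.
    have -> : p i - p j = (0, (p i).2 - (p j).2) by rewrite -[0](subrr (1 : K)).
    set y := (p i).2 - (p j).2.
    have y0 : y != 0.
      rewrite subr_eq0 /p /= nth_uniq // size_cat !size_map; exact: ltn_ord.
    by rewrite -(inv y 0 y) // mulr0 divff // subrr normr0.
  move=> i; rewrite /p /= !nth_cat !size_map ltn_ord ltnNge leq_addr /= addKn.
  rewrite !(nth_map (0, 0)) //.
  exact: (all_nthP (0, 0) al).
have [n nP] := bd.
have [l gl lmax] : exists2 l, good l &
    forall l', good l' -> (size l' <= size l)%N.
  elim: n nP {bd} => [h|n IH h]; first by have /h : good [::] by [].
  have [[l [gl sl]]|no] := pselect (exists l, good l /\ size l = n).
    by exists l => // l' /h; rewrite sl ltnS.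
  apply: IH => l gl; rewrite ltn_neqAle -ltnS h // andbT.
  by apply/eqP => sl; apply: no; exists l.
exists (unzip1 l ++ unzip2 l) => s s' sl sl'.
rewrite leNgt; apply/negP => lt.
have ss : s != s'.
  by apply: contraTneq lt => ->; rewrite subrr -leNgt ltW.
have := lmax ((s, s') :: l); rewrite ltnn => h; suff : false by [].
apply: h; case: gl => u a; split; last by rewrite /= (ltW lt).
rewrite /= -(cat1s s') uniq_catCA /= u sl' andbT !mem_cat inE.
by rewrite (negPf ss) /= -mem_cat sl.
Qed.

(** Choose [N] points on each of the hyperbolas [x y = q] and [x y = q']
    with all differences on hyperbolas outside the exceptional set: their
    inner products are then nearly equal, and [pd_separation] rules out a gap
    [d] between the values on the two hyperbolas once [N] is large. *)
Lemma torus_invariant_hyperbola_le (R : realType) (K : fieldType)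
    (Phi : K * K -> R) (q q' : K) :
  infinite_set [set: K] -> positive_definite Phi ->
  torus_invariant Phi ->
  q != 0 -> q' != 0 -> Phi (1, q) <= Phi (1, q').
Proof.
move=> Kinf pd inv q0 q'0.
have sym := torus_invariant_even inv.
rewrite leNgt; apply/negP => lt.
set d := Phi (1, q) - Phi (1, q').
have d0 : 0 < d by rewrite subr_gt0.
have a0 : 0 <= Phi 0 := le_trans (normr_ge0 _) (pd_bound 0 pd sym).
(* With this [e], the error [4 * N * Phi 0 * e] takes up at most half of
   [N * d ^+ 2]; adding 1 covers the case [Phi 0 = 0]. *)
pose e := d ^+ 2 / (8 * (Phi 0 + 1)).
have e0 : 0 < e by rewrite divr_gt0 ?exprn_gt0 ?mulr_gt0 // ltr_wpDl.
have [Ex ExP] := torus_invariant_almost_constant pd inv e0.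
have [s0 s0Ex] := infinite_fresh Kinf Ex.
have d20 : 0 < d ^+ 2 / 2 by rewrite divr_gt0 ?exprn_gt0.
have [n] := archimedean_succ (4 * Phi 0 ^+ 2) d20; move: n.+1 => N nP.
(* Avoiding [0] as well keeps the differences off the vertical axis, where
   [Phi] is not governed by the coordinate product. *)
have [rs [rsE rs0 rsP]] : exists rs : seq (K * K),
    [/\ [seq r.1 * r.2 | r <- rs] = nseq N q ++ nseq N q',
    all (fun p : K * K => p.1 != 0) rs &
    pairwise (fun r p : K * K => (r - p).1 * (r - p).2 \notin 0 :: Ex) rs].
  apply: generic_hyperbola_points => //.
  by rewrite all_cat !all_nseq q0 q'0 !orbT.
have srs : size rs = (N + N)%N.
  by rewrite -(size_map (fun r => r.1 * r.2)) rsE size_cat !size_nseq.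
pose p (i : 'I_(N + N)) : K * K := nth 0 rs i.
have psi r : r.1 * r.2 \notin 0 :: Ex -> `|Phi r - Phi (1, s0)| <= e.
  case: r => x y /=; rewrite inE negb_or mulf_eq0 negb_or.
  move=> /andP[/andP[x0 _] xy].
  rewrite (torus_invariantE inv) // ler_norml lerNl opprB.
  by rewrite !ExP.
have pP i j : i != j -> `|Phi (p i - p j) - Phi (1, s0)| <= e.
  wlog ij : i j / (i < j)%N => [H ij|_].
    move: (ij); rewrite neq_ltn => /orP[ij'|ij']; first exact: H.
    by rewrite -sym opprB; apply: H => //; rewrite eq_sym.
  by apply: psi; apply: (pairwiseP 0 rsP) => //; rewrite inE srs.
have pE i : Phi (p i) = Phi (1, nth 0 (nseq N q ++ nseq N q') i).
  rewrite -rsE (nth_map 0) ?srs //.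
  rewrite -(torus_invariantE inv) -?surjective_pairing //.
  by apply: (all_nthP 0 rs0); rewrite srs.
have : N%:R * d ^+ 2 <= 4 * Phi 0 ^+ 2 + 4 * N%:R * Phi 0 * e.
  apply: (pd_separation pd sym (ltW e0) (pd_bound _ pd sym) (ltW d0) pP) => i.
  rewrite !pE !nth_cat !size_nseq /= ltn_ord ltnNge leq_addr /= addKn !nth_nseq.
  by rewrite ltn_ord.
apply/negP; rewrite -ltNge.
have : 4 * N%:R * Phi 0 * e <= N%:R * (d ^+ 2 / 2).
  have -> : N%:R * (d ^+ 2 / 2) = 4 * N%:R * (Phi 0 + 1) * e.
    by rewrite /e; field; rewrite gt_eqF // ltr_wpDl.
  rewrite ler_wpM2r ?(ltW e0) // ler_wpM2l ?lerDl //.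
move: nP; set m := N%:R; set z := 4 * m * _ * e => h1 h2; lra.
Qed.

(** Points [(s, s)] on the diagonal have differences with nonzero coordinate
    product, so their inner products are all equal to [Phi (1, q)]; the square
    of the sum of [n] such vectors is [n Phi 0 + n (n - 1) Phi (1, q)]. *)
Lemma torus_invariant_hyperbola_ge0 (R : realType) (K : fieldType)
    (Phi : K * K -> R) (q : K) :
  infinite_set [set: K] -> positive_definite Phi ->
  torus_invariant Phi ->
  q != 0 -> 0 <= Phi (1, q).
Proof.
move=> Kinf pd inv q0; rewrite leNgt; apply/negP => lt.
have d0 : 0 < - Phi (1, q) by rewrite oppr_gt0.
have [n nP] := archimedean_succ (Phi 0) d0.
have [s [sz us]] := infinite_uniq Kinf n.+2.
pose p (i : 'I_n.+2) : K * K := (nth 0 s i, nth 0 s i).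
have := pd _ (fun=> 1) p; apply/negP; rewrite -ltNge.
under eq_bigr => i _.
  rewrite (bigD1 i) //= subrr !mul1r.
  under eq_bigr => j ji.
    rewrite ?mulr1 ?mul1r (_ : Phi _ = Phi (1, q)); first over.
    have ij0 : nth 0 s i - nth 0 s j != 0.
      by rewrite subr_eq0 nth_uniq ?sz // eq_sym.
    rewrite /p (torus_invariantE inv) //.
    by apply/eqP; rewrite eq_le !torus_invariant_hyperbola_le ?mulf_neq0.
  rewrite sumr_const cardC1 card_ord; over.
rewrite sumr_const card_ord pmulrn_llt0 // -[X in _ + X]mulr_natl.
move: nP; rewrite mulrN; set x := _.+1%:R * _ => nP; lra.
Qed.

(** * Recurrence along hyperbolas and products of difference sets *)

(** By shift invariance, the quadratic form is the mean of the square of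
    [z |-> \sum_i a i * f (z + p i)]. *)
Lemma correlation_pd (R : realType) (G : zmodType) (L : (G -> R) -> R)
    (f : G -> R) : mean L ->
  shift_invariant L -> bdd f ->
  positive_definite (fun p => L (fun z => f z * f (z + p))).
Proof.
move=> mL inv fb n a p.
have fs b : bdd (fun z => f (z + b)) by exact: bdd_comp.
have b2 b b' : bdd (fun z => f (z + b) * f (z + b')) by exact: bddM.
have b1 i : bdd (fun z => a i * f (z + p i)).
  by apply: bddM => //; exact: bdd_cst.
have -> : \sum_i \sum_j a i * a j * L (fun z => f z * f (z + (p i - p j))) =
    L (fun z => (\sum_i a i * f (z + p i)) * (\sum_i a i * f (z + p i))).
  have -> : (fun z => (\sum_i a i * f (z + p i)) * (\sum_i a i * f (z + p i))) =
      fun z => \sum_i \sum_j (a i * f (z + p i)) * (a j * f (z + p j)).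
    apply/funext => z; rewrite mulr_suml; apply: eq_bigr => i _.
    by rewrite mulr_sumr.
  rewrite mean_sum //; last by move=> i; apply: bdd_sum => j; exact: bddM.
  apply: eq_bigr => i _; rewrite mean_sum //; last by move=> j; exact: bddM.
  apply: eq_bigr => j _.
  rewrite -(inv (p j)); last by apply: bddM => //; exact: bdd_comp.
  rewrite -meanZ //; last first.
    by apply: bddM => //; apply: (bdd_comp (fun x => x + p j + (p i - p j))).
  congr L; apply/funext => z.
  rewrite -addrA [p j + _]addrC subrK; ring.
apply: (mean_ge0 mL); first by apply: bddM; exact: bdd_sum.
by move=> z; rewrite -expr2 sqr_ge0.
Qed.

Definition torus_average (R : realType) (K : fieldType) (T : (K -> R) -> R)
    (rho : K * K -> R) (p : K * K) : R := T (fun t => rho (t * p.1, p.2 / t)).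

Lemma torus_average_pd (R : realType) (K : fieldType) (T : (K -> R) -> R)
    (rho : K * K -> R) : mean T -> bdd rho -> positive_definite rho ->
  positive_definite (torus_average T rho).
Proof.
move=> mT rb pd n a p; rewrite /torus_average.
pose dil t (p : K * K) : K * K := (t * p.1, p.2 / t).
have rbs x : bdd (fun t => rho (dil t x)) by exact: (bdd_comp (dil^~ x)).
have rbc c x : bdd (fun t => c * rho (dil t x)).
  by apply: bddM => //; exact: bdd_cst.
have -> : \sum_i \sum_j a i * a j * T (fun t => rho (dil t (p i - p j))) =
    T (fun t => \sum_i \sum_j a i * a j * rho (dil t (p i - p j))).
  rewrite mean_sum //; last by move=> i; exact: bdd_sum.
  apply: eq_bigr => i _; rewrite mean_sum //.
  by apply: eq_bigr => j _; rewrite meanZ.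
apply: (mean_ge0 mT); first by apply: bdd_sum => i; exact: bdd_sum.
move=> t; have := pd n a (fun i => dil t (p i)).
congr (0 <= _); apply: eq_bigr => i _; apply: eq_bigr => j _.
by congr (_ * rho _); rewrite /dil mulrBr mulrBl.
Qed.

Lemma torus_average_invariant (R : realType) (K : fieldType)
    (T : (K -> R) -> R) (rho : K * K -> R) :
  (forall g h, g != 0 -> bdd h -> T (fun t => h (g * t)) = T h) -> bdd rho ->
  torus_invariant (torus_average T rho).
Proof.
move=> inv rb g x y g0; rewrite /torus_average /=.
rewrite -(inv g (fun t => rho (t * x, y / t))) //; last first.
  exact: (bdd_comp (fun t => (t * x, y / t))).
congr T; apply/funext => t; congr (rho (_, _)); first by rewrite mulrCA mulrA.
by rewrite invfM mulrA.
Qed.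

(** Otherwise the correlation of [\1_E - L \1_E] would be constantly negative
    on the whole hyperbola, and so would its torus average at [(1, q)]. *)
Lemma hyperbolic_recurrence (R : realType) (K : fieldType)
    (L : (K * K -> R) -> R) (E : set (K * K)) (q : K) :
  countable [set: K] -> infinite_set [set: K] -> mean L ->
  shift_invariant L ->
  0 < L (\1_E) -> q != 0 ->
  exists z u, [/\ u != 0, E z & E (z + (u, q / u))].
Proof.
move=> Kc Kinf mL inv a0 q0; apply: contrapT => no.
have [T [mT Tinv Text]] := multiplicative_mean R Kc.
set al := L (\1_E) in a0.
pose f z : R := \1_E z - al.
have ib : bdd (\1_E : K * K -> R) by exact: bdd_indic.
have fb : bdd f by apply: bddD => //; exact: (bdd_cst _ (- al)).
pose rho p := L (fun z => f z * f (z + p)).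
have rb : bdd rho.
  case: (fb) => M fM; exists (M * M) => p; apply: mean_norm => // z.
  by rewrite normrM ler_pM.
have Phi_ge0 := torus_invariant_hyperbola_ge0 Kinf
  (torus_average_pd mT rb (correlation_pd mL inv fb))
  (torus_average_invariant Tinv rb) q0.
move: Phi_ge0; apply/negP; rewrite -ltNge.
suff -> : torus_average T rho (1, q) = - al ^+ 2 by rewrite oppr_lt0 exprn_gt0.
rewrite /torus_average -(mean_cst (- al ^+ 2) mT).
(* For [u <> 0] the product [\1_E z * \1_E (z + (u, q / u))] is 0. *)
apply: Text => u u0 /=; rewrite mulr1 /rho.
have -> : (fun z => f z * f (z + (u, q / u))) =
    (fun z => al ^+ 2 - al * (\1_E z + \1_E (z + (u, q / u)))).
  apply/funext => z; rewrite /f.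
  have : \1_E z * \1_E (z + (u, q / u)) = 0 :> R.
    rewrite !indicE -natrM mulnb; case: andP => // -[].
    by rewrite !in_setE => Ez Ez'; case: no; exists z, u.
  by move=> h; rewrite mulrBr !mulrBl h; ring.
have sb : bdd (fun z => \1_E (z + (u, q / u)) : R) by exact: bdd_comp.
rewrite meanB //; last 2 first.
- exact: bdd_cst.
- by apply: bddM; [exact: bdd_cst|exact: bddD].
rewrite meanZ //; last exact: bddD.
rewrite meanD // mean_cst // inv // -/al; ring.
Qed.

Theorem corollary1p27 (R : realType) (K : fieldType)
  (K_countable : countable [set: K]) (K_infinite : infinite_set [set: K])
  (A B : set K)
  (A_density : (0 < upper_banach_density R A)%E)
  (B_density : (0 < upper_banach_density R B)%E) :
  (forall Q : set K, finite_set Q ->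
     exists a b : K,
       [/\ A a, B b &
           Q `<=` set_mul (set_translate A a) (set_translate B b)]) /\
  [set: K] = set_mul (set_diff A A) (set_diff B B).
Proof.
have main (Q : set K) : finite_set Q -> exists a b : K,
    [/\ A a, B b & Q `<=` set_mul (set_translate A a) (set_translate B b)].
  move=> /finite_seqP[s ->]; apply: contrapT => no.
  have [LA [mA invA A0]] := density_mean A_density.
  have [LB [mB invB B0]] := density_mean B_density.
  pose L (h : K * K -> R) := LA (fun x => LB (fun y => h (x, y))).
  have mL : mean L by exact: (prod_mean mA mB).
  have inv : shift_invariant L.
    move=> b h hb; rewrite /L.
    rewrite -(invA b.1 (fun x => LB (fun y => h (x, y)))); last first.
      by case: hb => M hM; exists M => x; exact: (mean_norm mB).
    congr LA; apply/funext => x.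
    rewrite -(invB b.2 (fun y => h (x + b.1, y))) //.
    exact: (bdd_comp (fun y => (x + b.1, y))).
  pose bad q : set (K * K) := [set z | [/\ A z.1, B z.2 &
    ~ set_mul (set_translate A z.1) (set_translate B z.2) q]].
  have LAB : 0 < L (\1_(A `*` B)).
    rewrite (_ : L _ = LA (\1_A) * LB (\1_B)) ?mulr_gt0 //.
    rewrite /L mulrC -meanZ //; last exact: bdd_indic.
    congr LA; apply/funext => x; rewrite mulrC -meanZ //; last exact: bdd_indic.
    congr LB; apply/funext => y; rewrite !indicE -natrM mulnb; congr (_%:R).
    by rewrite in_setX.
  have [q [q0 Lq]] : exists q, q != 0 /\ 0 < L (\1_(bad q)).
    apply: contrapT => nq.
    move: LAB; apply/negP; rewrite -leNgt.
    apply: (@le_trans _ _ (L (fun z => \sum_(q <- s) \1_(bad q) z))).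
      apply: mean_le => //; first exact: bdd_indic.
        by apply: bdd_sum => q; exact: bdd_indic.
      move=> z; rewrite indicE.
      case: (boolP (z \in A `*` B)) => [|_]; last first.
        by rewrite sumr_ge0.
      rewrite in_setE => -[Az Bz].
      have [q qs nqz] : exists2 q, q \in s &
          ~ set_mul (set_translate A z.1) (set_translate B z.2) q.
        apply: contrapT => h; apply: no; exists z.1, z.2; split => // q /= qs.
        by apply: contrapT => h'; apply: h; exists q.
      rewrite (big_rem q) //= indicE mem_set // lerDl.
      by apply: sumr_ge0.
    rewrite mean_sum //; last by move=> q; exact: bdd_indic.
    (* There are no bad pairs for [q = 0], which is [(a - a) * (b - b)]. *)
    apply: sumr_le0 => q _; have [->|q0] := eqVneq q 0; last first.
      by rewrite leNgt; apply/negP => h; apply: nq; exists q.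
    rewrite (_ : \1_(bad 0) = fun=> 0) ?mean_cst //.
    apply/funext => z; rewrite indicE memNset // => -[Az Bz]; apply.
    exists 0; first by exists z.1 => //; rewrite subrr.
    by exists 0; [exists z.2 => //; rewrite subrr|rewrite mulr0].
  have [z [u [u0 [Az Bz nz] [Azu Bzu _]]]] :=
    hyperbolic_recurrence K_countable K_infinite mL inv Lq q0.
  apply: nz; exists u.
    by exists (z.1 + u) => //; rewrite addrAC subrr add0r.
  exists (q / u); last by rewrite mulrC divfK.
  by exists (z.2 + q / u) => //; rewrite addrAC subrr add0r.
split=> //; apply/seteqP; split=> // x _.
have [a [b [Aa Bb /(_ x erefl)]]] := main [set x] (finite_set1 x).
move=> [_ [a' Aa' <-]] [_ [b' Bb' <-]] xE.
exists (a' - a); first by exists a' => //; exists a.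
by exists (b' - b) => //; exists b' => //; exists b.
Qed.
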